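(* For $n \ge 2$, let $T_n$ be a random round-robin tournament on $n$ labeled vertices (players) $1,\dots,n$: for each unordered pair $\{i,j\}$, $i\neq j$, independently, exactly one of $X_{ij}, X_{ji}$ equals $1$ and the other equals $0$, with $P(X_{ij}=1)=P(X_{ji}=1)=1/2$ (equivalently, all $2^{\binom{n}{2}}$ tournaments on $n$ labeled vertices are equally likely). Let $s_i=\sum_{j\neq i}X_{ij}$ be the score of vertex $i$ and $s^{\star}=\max_{1\le i\le n}s_i$. Then the probability that $T_n$ has a unique vertex with score $s^{\star}$ tends to $1$ as $n\to\infty$. In particular, fix a constant $\epsilon$ with $0<\epsilon<1$, and for $n$ large enough that the following is defined let $$x_{n-1}=\big(2\log(n-1)-(1+\epsilon)\log(\log(n-1))\big)^{1/2},\qquad t_{n-1}=\Big\lceil \tfrac{n-1}{2}+x_{n-1}\big(\tfrac{n-1}{4}\big)^{1/2}\Big\rceil .$$ Then: (i) $P(s^{\star}>t_{n-1})\to 1$ as $n\to\infty$; (ii) if $W_n$ denotes the number of ordered pairs $(u,v)$ of distinct vertices of $T_n$ such that $s_u=s_v=h$ for some integer $h$ with $t_{n-1}\le h\le n-1$, then $P(W_n>0)\to 0$ as $n\to\infty$.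
   Context: $\log$ denotes the natural logarithm and $\lceil\cdot\rceil$ the ceiling function. A round-robin tournament is a complete oriented graph: each pair of distinct players plays exactly one game, and $X_{ij}=1$ means player $i$ beats player $j$ (so $X_{ij}+X_{ji}=1$). *)

(* Defs.v *)
From HB Require Import structures.
From mathcomp Require Import all_boot all_order all_algebra.
From mathcomp Require Import all_classical all_reals all_analysis.

Set Implicit Arguments.
Unset Strict Implicit.
Unset Printing Implicit Defensive.

Import Order.TTheory GRing.Theory Num.Theory.
Import numFieldNormedType.Exports.

Local Open Scope ring_scope.

(* [X (i, j)] means "i beats j"; players 1, ..., n are the elements of 'I_n. *)
Definition is_tournament (n : nat) (X : {ffun 'I_n * 'I_n -> bool}) : bool :=
  [forall i : 'I_n, ~~ X (i, i)] &&
  [forall i : 'I_n, forall j : 'I_n, (i != j) ==> (X (j, i) == ~~ X (i, j))].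

Definition tournament (n : nat) : Type :=
  {X : {ffun 'I_n * 'I_n -> bool} | is_tournament X}.

HB.instance Definition _ (n : nat) := SubFinite.on (tournament n).

Definition beats (n : nat) (T : tournament n) (i j : 'I_n) : bool :=
  val T (i, j).

(* All tournaments on n labeled vertices are equally likely; equivalently, the
   games are independent and fair. *)
Definition Pr (R : realType) (n : nat) (E : pred (tournament n)) : R :=
  #|[set T : tournament n | E T]%SET|%:R / #|{: tournament n}|%:R.

Definition score (n : nat) (T : tournament n) (i : 'I_n) : nat :=
  (\sum_(j < n | j != i) beats T i j)%N.

Definition max_score (n : nat) (T : tournament n) : nat :=
  (\max_(i < n) score T i)%N.

Definition unique_max (n : nat) (T : tournament n) : bool :=
  #|[set i : 'I_n | score T i == max_score T]%SET| == 1%N.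

(* [ln] and [Num.sqrt] are total (0 outside their natural domains); this matters
   only for finitely many m for each fixed eps. *)
Definition x_ (R : realType) (eps : R) (m : nat) : R :=
  Num.sqrt (2 * ln m%:R - (1 + eps) * ln (ln m%:R)).

Definition t_ (R : realType) (eps : R) (m : nat) : int :=
  Num.ceil (m%:R / 2 + x_ eps m * Num.sqrt (m%:R / 4)).

(* The common score h is an integer with t <= h <= n - 1; scores being natural
   numbers, h ranges over 'I_n. *)
Definition num_ties (n : nat) (t : int) (T : tournament n) : nat :=
  #|[set uv : 'I_n * 'I_n | (uv.1 != uv.2) &&
      [exists h : 'I_n, [&& t <= (h : nat)%:Z, score T uv.1 == h
                          & score T uv.2 == h]]]%SET|.

(* Main.v *)
(* Fix two players u, v and let a, c be the numbers of wins of u and of v against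
   the other n - 2 players. Flipping games shows that a, c and the game between u
   and v are independent, so the pair of scores is (a + 1, c) or (a, c + 1) with
   probability 1/2 each, a and c being Bin(n - 2, 1/2).

   (i) With q k = P(Bin(n - 2, 1/2) >= k), P(s_u > t) = (q t + q (t + 1)) / 2 and
   P(s_u > t, s_v > t) = q t * q (t + 1), so the events s_u > t are negatively
   correlated and Chebyshev gives P(max <= t) <= 1 / (n q (t + 1)). Bounding the
   tail below by about sqrt m / x equal terms, m = n - 1, the denominator is at
   least a constant times (log m) ^ (eps / 2).

   (ii) P(s_u = s_v > T) is the sum over a >= T of b a * b (a + 1), where b is the
   mass function of Bin(n - 2, 1/2). It is at most b T * q T, and q T is controlled
   by b T (Mills ratio). As b T is about m ^ (-1/2) exp (- x ^ 2 / 2), summing over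
   the pairs gives O((log m) ^ 2 / sqrt m) = O(1 / log m).

   If max > t is not attained uniquely then there is a tie above t, so uniqueness
   follows from (i) and (ii) with eps = 1/2. *)

Require Import Defs.
From mathcomp Require Import all_boot all_order all_algebra.
From mathcomp Require Import all_classical all_reals all_analysis.
From mathcomp Require Import ring lra zify.

Set Implicit Arguments.
Unset Strict Implicit.
Unset Printing Implicit Defensive.

Import Order.TTheory GRing.Theory Num.Theory.
Import numFieldNormedType.Exports.

Local Open Scope classical_set_scope.
Local Open Scope ring_scope.

(** * Joint law of two scores *)

Section Profile.
Local Open Scope nat_scope.
Local Open Scope set_scope.

Lemma beatsii (n : nat) (T : tournament n) (i : 'I_n) : beats T i i = false.
Proof. by have /andP[/forallP/(_ i)/negbTE] := valP T. Qed.

Lemma beatsC (n : nat) (T : tournament n) (i j : 'I_n) :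
  i != j -> beats T j i = ~~ beats T i j.
Proof.
by have /andP[_ /forallP/(_ i)/forallP/(_ j)/implyP h] := valP T => /h/eqP.
Qed.

Lemma tournament_ext (n : nat) (T T' : tournament n) :
  (forall i j, i != j -> beats T i j = beats T' i j) -> T = T'.
Proof.
move=> h; apply/val_inj/ffunP => -[i j].
by have [->|/h//] := eqVneq i j; have := beatsii T j; have := beatsii T' j;
  rewrite /beats => -> ->.
Qed.

Lemma tournamentP (n : nat) (r : rel 'I_n) :
  (forall i j, i != j -> r j i = ~~ r i j) ->
  {T : tournament n | forall i j, i != j -> beats T i j = r i j}.
Proof.
move=> rC; pose X := [ffun p : 'I_n * 'I_n => (p.1 != p.2) && r p.1 p.2].
have XP : is_tournament X.
  apply/andP; split; first by apply/forallP => i; rewrite ffunE eqxx.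
  apply/forallP => i; apply/forallP => j; apply/implyP => ij.
  by rewrite !ffunE /= (eq_sym j i) ij /= rC.
by exists (exist _ X XP) => i j ij; rewrite /beats /= ffunE ij.
Qed.

Lemma tournament_gt0 (n : nat) : 0 < #|{: tournament n}|.
Proof.
have ltC (i j : 'I_n) : i != j -> (j < i) = ~~ (i < j).
  by move=> ij; rewrite -leqNgt [RHS]leq_eqVlt val_eqE eq_sym (negbTE ij).
have [T _] := tournamentP ltC.
by apply/card_gt0P; exists T.
Qed.

(** Symmetry of [g] is what keeps the two entries of each game complementary after the xor. *)
Definition flip (n : nat) (g : 'I_n -> 'I_n -> bool)
    (gC : forall i j, g i j = g j i) (T : tournament n) : tournament n :=
  sval (@tournamentP n (fun i j => beats T i j (+) g i j)
    (fun i j ij => etrans (congr2 addb (beatsC T ij) (gC j i)) (addNb _ _))).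

Lemma flipE (n : nat) (g : 'I_n -> 'I_n -> bool)
    (gC : forall i j, g i j = g j i) (T : tournament n) (i j : 'I_n) :
  i != j -> beats (flip gC T) i j = beats T i j (+) g i j.
Proof. by rewrite /flip; case: tournamentP => T' /= h /h. Qed.

Lemma flip_inj (n : nat) (g : 'I_n -> 'I_n -> bool)
  (gC : forall i j, g i j = g j i) : injective (flip gC).
Proof.
move=> T T' e; apply: tournament_ext => i j ij.
by apply: (can_inj (addbK (g i j))); rewrite -!(flipE gC) // e.
Qed.

Definition others (n : nat) (u v : 'I_n) : {set 'I_n} := ~: [set u; v].

Lemma card_others (n : nat) (u v : 'I_n) : u != v -> #|others u v| = n.-2.
Proof. by move=> uv; rewrite cardsCs finset.setCK cards2 uv card_ord subn2. Qed.

Definition wins_among (n : nat) (S : {set 'I_n}) (T : tournament n)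
  (u : 'I_n) : {set 'I_n} := [set w in S | beats T u w].

(** The outcomes of exactly those games that involve [u] or [v]; both scores can be read off from
    them. *)
Definition profile (n : nat) (u v : 'I_n) (T : tournament n) :=
  (wins_among (others u v) T u, wins_among (others u v) T v, beats T u v).

Definition profiles (n : nat) (u v : 'I_n) : {set {set 'I_n} * {set 'I_n} * bool} :=
  finset.setX (finset.setX (powerset (others u v)) (powerset (others u v))) [set: bool].

Lemma profileP (n : nat) (u v : 'I_n) (T : tournament n) :
  profile u v T \in profiles u v.
Proof.
rewrite !inE /= andbT; apply/andP.
by split; apply/fintype.subsetP => w; rewrite inE => /andP[].
Qed.

(* Flipping the games on which the two profiles disagree maps one fiber
   injectively into the other. *)
Lemma leq_card_fiber (n : nat) (u v : 'I_n) d d' : u != v ->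
  d \in profiles u v -> d' \in profiles u v ->
  #|[set T | profile u v T == d]| <= #|[set T | profile u v T == d']|.
Proof.
move=> uv; case: d => [[A B] x]; case: d' => [[A' B'] x'].
rewrite !inE /= !andbT => /andP[sA sB] /andP[sA' sB'].
(* [e] marks the disagreements as seen from [u] or from [v]; [g] symmetrises it, as [flip]
   demands. *)
pose e i j := [|| (i == u) && (j \in others u v) && ((j \in A) (+) (j \in A')),
  (i == v) && (j \in others u v) && ((j \in B) (+) (j \in B'))
  | (i == u) && (j == v) && (x (+) x')].
pose g i j := e i j || e j i.
have gC i j : g i j = g j i by rewrite /g orbC.
rewrite -(card_imset _ (@flip_inj _ g gC)).
apply/subset_leq_card/fintype.subsetP => _ /imsetP[T + ->].
rewrite !inE => /eqP[eA eB ex].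
have vu : (v == u) = false by rewrite eq_sym (negbTE uv).
have oP w : w \in others u v -> (w == u) = false /\ (w == v) = false.
  by rewrite !inE negb_or => /andP[/negbTE -> /negbTE ->].
have ou : u \in others u v = false by rewrite !inE eqxx.
have ov : v \in others u v = false by rewrite !inE eqxx orbT.
have uvE : (u == v) = false by exact: negbTE.
apply/eqP; congr (_, _, _).
- apply/setP => w; rewrite inE.
  case ow: (w \in others u v) => /=; last first.
    by apply/esym/negbTE; apply: contraFN ow; apply/fintype.subsetP.
  have [wu wv] := oP _ ow.
  have := congr1 (fun S : {set 'I_n} => w \in S) eA; rewrite inE ow /= => eAw.
  rewrite flipE ?(eq_sym u) ?wu// eAw /g /e !eqxx ow wu wv uvE ou/= !orbF.
  by rewrite addKb.
- apply/setP => w; rewrite inE.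
  case ow: (w \in others u v) => /=; last first.
    by apply/esym/negbTE; apply: contraFN ow; apply/fintype.subsetP.
  have [wu wv] := oP _ ow.
  have := congr1 (fun S : {set 'I_n} => w \in S) eB; rewrite inE ow /= => eBw.
  rewrite flipE ?(eq_sym v) ?wv// eBw /g /e !eqxx ow wu wv vu ov/= !orbF.
  by rewrite addKb.
- rewrite flipE // ex /g /e !eqxx ou ov uvE vu /= ?orbF addKb //.
Qed.

(** All fibers of [profile u v] have the same size, so the profile of a uniform tournament is
    uniform on [profiles u v]. The product form avoids division. *)
Lemma card_profile (n : nat) (u v : 'I_n) (P : pred _) : u != v ->
  #|[set T | P (profile u v T)]| * #|profiles u v|
  = #|[set d in profiles u v | P d]| * #|{: tournament n}|.
Proof.
move=> uv.
have [T0 _] : {T : tournament n | T \in predT}.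
  case: (pickP (@predT (tournament n))) (tournament_gt0 n) => [T _ _|/eq_card0 -> //].
  by exists T.
pose F := #|[set T | profile u v T == profile u v T0]|.
have fF d : d \in profiles u v -> #|[set T | profile u v T == d]| = F.
  by move=> dP; apply/eqP; rewrite eqn_leq !leq_card_fiber ?profileP.
have key (Q : pred _) : #|[set T | Q (profile u v T)]|
    = #|[set d in profiles u v | Q d]| * F.
  rewrite -sum_nat_const -sum1_card.
  rewrite (partition_big (profile u v) (fun d => (d \in profiles u v) && Q d)) /=.
    apply: eq_big => [d|d /andP[dP Qd]]; first by rewrite [RHS]finset.in_set.
    rewrite -(fF d dP) -sum1_card; apply: eq_bigl => T; rewrite !inE.
    by case: eqP => [->|_]; rewrite ?Qd ?andbF.
  by move=> T; rewrite finset.in_set profileP.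
have := key predT.
have -> : [set T : tournament n | predT (profile u v T)] = [set: tournament n].
  by apply/setP => T; rewrite !inE.
have -> : [set d in profiles u v | predT d] = profiles u v.
  by apply/setP => d; rewrite !inE /= andbT.
rewrite cardsT key => ->; lia.
Qed.

Lemma score_profile (n : nat) (u v : 'I_n) (T : tournament n) : u != v ->
  score T u = #|(profile u v T).1.1| + (profile u v T).2 /\
  score T v = #|(profile u v T).1.2| + ~~ (profile u v T).2.
Proof.
move=> uv; have gen i j (S : {set 'I_n}) : i != j -> S = others i j ->
    score T i = #|wins_among S T i| + beats T i j.
  move=> ij ->; rewrite /score (bigD1 j) 1?eq_sym //= addnC; congr (_ + _).
  rewrite -sum1_card big_mkcond [RHS]big_mkcond; apply: eq_bigr => w _.
  by rewrite !inE negb_or; do 2!case: eqP => //=; case: beats.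
split; first exact: gen.
rewrite -beatsC //=; apply: gen; first by rewrite eq_sym.
by rewrite /others finset.setUC.
Qed.
End Profile.

(** * Binomial form of the joint law of two scores *)

Lemma sum_powerset (T : finType) (W : {set T}) (F : nat -> nat) :
  (\sum_(A in powerset W) F #|A| = \sum_(a < #|W|.+1) 'C(#|W|, a) * F a)%N.
Proof.
rewrite (partition_big (fun A : {set T} => inord #|A| : 'I_#|W|.+1) predT) //=.
apply: eq_bigr => a _; rewrite -cards_draws -sum_nat_const.
apply: eq_big => [A|A /andP[/[!powersetE] AW /eqP <-]].
  rewrite powersetE finset.in_set; case AW: (A \subset W) => //=.
  by rewrite -val_eqE /= inordK // ltnS subset_leq_card.
by rewrite inordK // ltnS subset_leq_card.
Qed.

(** Grouping the win sets by size produces the binomial coefficients; [Q a.+1 c] and [Q a c.+1] come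
    from the two outcomes of the game between [u] and [v]. *)
Lemma card_profiles_score (n : nat) (u v : 'I_n) (Q : nat -> nat -> bool) :
  u != v ->
  #|[set d in profiles u v | Q (#|d.1.1| + d.2) (#|d.1.2| + ~~ d.2)]%SET| =
  (\sum_(a < n.-2.+1) 'C(n.-2, a) *
     \sum_(c < n.-2.+1) 'C(n.-2, c) * (Q a.+1 c + Q a c.+1))%N.
Proof.
move=> uv; rewrite -(card_others uv) -sum1_card.
transitivity (\sum_(A in powerset (others u v)) \sum_(B in powerset (others u v))
   \sum_(x : bool) Q (#|A| + x) (#|B| + ~~ x))%N; last first.
  rewrite -(sum_powerset _ (fun a => \sum_(c < #|others u v|.+1)
    'C(#|others u v|, c) * (Q a.+1 c + Q a c.+1)))%N.
  apply: eq_bigr => A _.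
  rewrite -(sum_powerset _ (fun c => Q #|A|.+1 c + Q #|A| c.+1))%N.
  by apply: eq_bigr => B _; rewrite big_bool /= addn1 addn0 addn1 addn0.
rewrite !pair_big /= [RHS](bigID (fun d : {set 'I_n} * {set 'I_n} * bool =>
  Q (#|d.1.1| + d.2) (#|d.1.2| + ~~ d.2))%N) /=.
rewrite [X in (_ + X)%N]big1 ?addn0 => [|d /andP[_ /negbTE ->]//].
apply: eq_big => [[[A B] x]|d]; last by rewrite finset.in_set => /andP[_ ->].
by rewrite finset.in_set !finset.in_setX finset.in_setT !andbT.
Qed.

Definition binom_pmf (R : realType) (M h : nat) : R := 'C(M, h)%:R / 2 ^+ M.

Lemma sum_binom_pmf (R : realType) (M : nat) :
  \sum_(a < M.+1) binom_pmf R M a = 1.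
Proof.
rewrite -mulr_suml -natr_sum.
have -> : (\sum_(a < M.+1) 'C(M, a) = 2 ^ M)%N.
  rewrite -[2%N]/(1 + 1)%N expnDn; apply: eq_bigr => i _.
  by rewrite !exp1n !muln1.
by rewrite natrX divff // expf_neq0.
Qed.

Lemma Pr_score_pair (R : realType) (n : nat) (u v : 'I_n)
    (Q : nat -> nat -> bool) : u != v ->
  Pr R (fun T : tournament n => Q (score T u) (score T v)) =
  2^-1 * \sum_(a < n.-2.+1) binom_pmf R n.-2 a *
    \sum_(c < n.-2.+1) binom_pmf R n.-2 c * ((Q a.+1 c)%:R + (Q a c.+1)%:R).
Proof.
move=> uv; pose N := #|{: tournament n}|.
have N0 : N%:R != 0 :> R by rewrite pnatr_eq0 -lt0n tournament_gt0.
have := card_profile (fun d : {set 'I_n} * {set 'I_n} * bool =>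
  Q (#|d.1.1| + d.2)%N (#|d.1.2| + ~~ d.2)%N) uv.
rewrite card_profiles_score //.
have -> : [set T : tournament n | Q (#|(profile u v T).1.1| + (profile u v T).2)%N
   (#|(profile u v T).1.2| + ~~ (profile u v T).2)%N]%SET =
   [set T : tournament n | Q (score T u) (score T v)]%SET.
  by apply/setP => T; rewrite !finset.in_set; have [-> ->] := score_profile T uv.
have -> : #|profiles u v| = (2 ^ n.-2 * 2 ^ n.-2 * 2)%N.
  by rewrite !cardsX card_powerset cardsT card_bool card_others.
move/(congr1 (fun k => k%:R : R)); rewrite !natrM natr_sum !natrX => e.
rewrite /Pr -/N.
have -> : \sum_(a < n.-2.+1) binom_pmf R n.-2 a *
    \sum_(c < n.-2.+1) binom_pmf R n.-2 c * ((Q a.+1 c)%:R + (Q a c.+1)%:R) =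
    (\sum_(a < n.-2.+1) ('C(n.-2, a) *
     \sum_(c < n.-2.+1) 'C(n.-2, c) * (Q a.+1 c + Q a c.+1))%N%:R)
    / (2 ^+ n.-2 * 2 ^+ n.-2).
  rewrite mulr_suml; apply: eq_bigr => a _; rewrite natrM natr_sum.
  rewrite /binom_pmf invfM mulrACA; congr (_ * _).
  rewrite mulr_suml; apply: eq_bigr => c _.
  by rewrite natrM natrD mulrAC.
have p0 : 2 ^+ n.-2 != 0 :> R by rewrite expf_neq0.
set S := \sum_(a < _) _ in e *; set c := (#|_|%:R : R) in e *.
apply: (mulIf N0); rewrite divfK //.
apply: (@mulIf _ (2 ^+ n.-2 * 2 ^+ n.-2 * 2)); first by rewrite !mulf_neq0.
by rewrite e; field.
Qed.

Definition binom_tail (R : realType) (M k : nat) : R :=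
  \sum_(a < M.+1 | (k <= a)%N) binom_pmf R M a.

(** * Probabilities of score events; first and second moment bounds *)

Section ScoreEvents.
Variables (R : realType) (n : nat).
Local Notation b := (binom_pmf R n.-2).
Local Notation q := (binom_tail R n.-2).

Lemma binom_tailE (k : nat) : \sum_(a < n.-2.+1) b a * (k <= a)%:R = q k.
Proof.
rewrite /binom_tail [RHS]big_mkcond; apply: eq_bigr => a _.
by case: leq; rewrite ?mulr1 ?mulr0.
Qed.

(** Whoever wins the game between [u] and [v] needs only [t] further wins, the loser [t.+1]; so both
    outcomes contribute the same product. *)
Lemma Pr_score_gt2 (u v : 'I_n) (t : nat) : u != v ->
  Pr R (fun T => (t < score T u)%N && (t < score T v)%N) = q t * q t.+1.
Proof.
move=> uv; rewrite (Pr_score_pair R (fun a c => (t < a)%N && (t < c)%N) uv) /=.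
have -> : \sum_(a < n.-2.+1) b a * \sum_(c < n.-2.+1) b c *
    (((t < a.+1)%N && (t < c)%N)%:R + ((t < a)%N && (t < c.+1)%N)%:R)
    = \sum_(a < n.-2.+1) (b a * (t <= a)%:R * q t.+1 + b a * (t < a)%:R * q t).
  apply: eq_bigr => a _; rewrite -!mulrA -mulrDr; congr (_ * _).
  rewrite -!binom_tailE !mulr_sumr -big_split; apply: eq_bigr => c _; rewrite !ltnS /=.
  by rewrite -!mulnb !natrM; ring.
by rewrite big_split /= -!mulr_suml !binom_tailE; field.
Qed.

Lemma Pr_score_gt (u : 'I_n) (t : nat) : (1 < n)%N ->
  Pr R (fun T => (t < score T u)%N) = (q t + q t.+1) / 2.
Proof.
(* The law of one score is taken as a marginal of the law of a pair, hence the auxiliary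
   opponent. *)
move=> n1; have [v uv] : exists v : 'I_n, u != v.
  pose f (k : nat) (h : (k < n)%N) := Ordinal h.
  have [->|] := eqVneq u (f 0%N (ltnW n1)); last by exists (f 0%N (ltnW n1)).
  by exists (f 1%N n1); rewrite -val_eqE.
rewrite (Pr_score_pair R (fun a c => (t < a)%N) uv) /= mulrC; congr (_ / _).
rewrite -!binom_tailE -big_split; apply: eq_bigr => a _ /=.
by rewrite -mulr_suml sum_binom_pmf mul1r mulrDr ltnS.
Qed.

(** Exchanging [a] and [c] shows that the two outcomes of the game between [u] and [v] contribute
    equally, which cancels the factor 1/2. *)
Lemma Pr_tie (u v : 'I_n) (t : nat) : u != v ->
  Pr R (fun T => (score T u == score T v) && (t < score T u)%N) =
  \sum_(a < n.-2.+1 | (t <= a)%N) b a * b a.+1.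
Proof.
move=> uv; rewrite (Pr_score_pair R (fun a c => (a == c) && (t < a)%N) uv) /=.
have E (a : 'I_n.-2.+1) : \sum_(c < n.-2.+1) b c * ((a.+1 == c) && (t <= a)%N)%:R
    = b a.+1 * (t <= a)%:R.
  (* If [a.+1] is out of range, no index [c] matches it and [b a.+1] is 0 as well. *)
  have [aM|aM] := ltnP a.+1 n.-2.+1.
    rewrite (bigD1 (Ordinal aM)) //= eqxx /= big1 ?addr0 // => c.
    by rewrite -val_eqE eq_sym => /negbTE /= ->; rewrite mulr0.
  rewrite /binom_pmf bin_small ?mul0r// big1 // => c _.
  by rewrite gtn_eqF ?mulr0// (leq_trans (ltn_ord c)).
transitivity (2^-1 * (\sum_(a < n.-2.+1) b a * (b a.+1 * (t <= a)%:R) +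
   \sum_(a < n.-2.+1) b a * (b a.+1 * (t <= a)%:R))).
  congr (_ * _); under eq_bigr do under eq_bigr do rewrite mulrDr.
  under eq_bigr do rewrite big_split mulrDr.
  rewrite big_split /=; congr (_ + _); first by apply: eq_bigr => a _; rewrite E.
  under eq_bigr do rewrite mulr_sumr.
  rewrite exchange_big /=; apply: eq_bigr => a _; rewrite -E mulr_sumr.
  apply: eq_bigr => c _; rewrite mulrCA eq_sym; congr (_ * (_ * _%:R)).
  by congr nat_of_bool; case: eqP => // <-.
set S := \sum_(a < _) _; have -> : 2^-1 * (S + S) = S by field.
rewrite [RHS]big_mkcond.
by apply: eq_bigr => a _; case: leq; rewrite ?mulr1 ?mulr0.
Qed.

Lemma PrE (E : pred (tournament n)) :
  Pr R E = (\sum_(T : tournament n) (E T)%:R) / #|{: tournament n}|%:R.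
Proof.
rewrite /Pr -sum1_card natr_sum big_mkcond; congr (_ / _).
by apply: eq_bigr => T _; rewrite finset.in_set; case: (E T).
Qed.

Lemma Pr_ge0 (E : pred (tournament n)) : 0 <= Pr R E.
Proof. by rewrite divr_ge0. Qed.

(** Union bound. The index type is arbitrary: it serves for pairs of players and, with [bool], for a
    case split. *)
Lemma Pr_le_sum (I : finType) (E : pred (tournament n)) (F : I -> pred (tournament n)) :
  (forall T, E T -> exists i, F i T) -> Pr R E <= \sum_i Pr R (F i).
Proof.
move=> h; under eq_bigr do rewrite PrE; rewrite PrE -mulr_suml ler_wpM2r ?invr_ge0//.
rewrite exchange_big; apply: ler_sum => T _ /=.
case ET: (E T); last by apply: sumr_ge0.
by have [i Fi] := h T ET; rewrite (bigD1 i) //= Fi lerDl sumr_ge0.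
Qed.

Lemma PrC (E : pred (tournament n)) : Pr R (fun T => ~~ E T) = 1 - Pr R E.
Proof.
have N0 : #|{: tournament n}|%:R != 0 :> R by rewrite pnatr_eq0 -lt0n tournament_gt0.
apply: (mulIf N0); rewrite mulrBl mul1r !PrE !divfK //.
rewrite -[in RHS]sum1_card natr_sum -sumrB; apply: eq_bigr => T _.
by case: (E T); rewrite ?subrr ?subr0.
Qed.

(* Chebyshev's inequality for the number of [i] such that [A i] holds. *)
Lemma Pr_none_le (I : finType) (A : I -> pred (tournament n)) (p : R) :
  0 < p -> (0 < #|I|)%N -> (forall i, Pr R (A i) = p) ->
  (forall i j, i != j -> Pr R (fun T => A i T && A j T) <= p ^+ 2) ->
  Pr R (fun T => ~~ [exists i, A i T]) <= (#|I|%:R * p)^-1.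
Proof.
move=> p0 I0 hp hpp; set N := #|{: tournament n}|; set k : R := #|I|%:R.
have N0 : 0 < N%:R :> R by rewrite ltr0n tournament_gt0.
have k0 : 0 < k by rewrite ltr0n.
pose Z T : R := \sum_i (A i T)%:R.
have SZ : \sum_(T : tournament n) Z T = N%:R * (k * p).
  transitivity (\sum_(i : I) p * N%:R); last first.
    by rewrite sumr_const -[LHS]mulr_natl -/k; ring.
  rewrite exchange_big /=; apply: eq_bigr => i _.
  by rewrite -(hp i) PrE divfK // gt_eqF.
(* The diagonal contributes [k * p]; the [k * (k - 1)] other pairs are counted as [k ^+ 2]. *)
have SZ2 : \sum_(T : tournament n) Z T ^+ 2 <= N%:R * (k * p + k ^+ 2 * p ^+ 2).
  have -> : \sum_(T : tournament n) Z T ^+ 2 =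
      \sum_i \sum_j N%:R * Pr R (fun T => A i T && A j T).
    under eq_bigr do rewrite expr2 mulr_suml.
    rewrite exchange_big; apply: eq_bigr => i _ /=.
    under eq_bigr do rewrite mulr_sumr.
    rewrite exchange_big; apply: eq_bigr => j _ /=.
    rewrite PrE mulrC divfK ?gt_eqF //.
    by apply: eq_bigr => T _; rewrite -mulnb natrM.
  have -> : N%:R * (k * p + k ^+ 2 * p ^+ 2) = \sum_(i : I) (N%:R * (p + k * p ^+ 2)).
    by rewrite sumr_const -[RHS]mulr_natl -/k; ring.
  apply: ler_sum => i _; rewrite (bigD1 i) //= -mulr_sumr -mulrDr ler_pM2l //.
  apply: lerD; first by under eq_fun do rewrite andbb; rewrite hp.
  apply: (@le_trans _ _ (\sum_(j | j != i) p ^+ 2)).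
    by apply: ler_sum => j ji; apply: hpp; rewrite eq_sym.
  rewrite sumr_const -mulr_natl ler_wpM2r ?sqr_ge0 // ler_nat.
  by rewrite max_card.
(* Where no [A i] holds, [Z] is 0 and deviates from its mean by [k * p]. In the total squared
   deviation the terms in [(k * p) ^+ 2] cancel. *)
have key : N%:R * Pr R (fun T => ~~ [exists i, A i T]) * (k * p) ^+ 2 <= N%:R * (k * p).
  apply: (@le_trans _ _ (\sum_(T : tournament n) (Z T - k * p) ^+ 2)).
    rewrite PrE [_ * (_ / _)]mulrC divfK ?gt_eqF // mulr_suml; apply: ler_sum => T _.
    case: existsP => /= [_|nA]; first by rewrite mul0r sqr_ge0.
    have -> : Z T = 0.
      by rewrite /Z big1 // => i _; case AT: (A i T) => //; case: nA; exists i.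
    by rewrite mul1r sub0r sqrrN.
  have -> : \sum_(T : tournament n) (Z T - k * p) ^+ 2 =
     \sum_(T : tournament n) Z T ^+ 2 - 2 * (k * p) * (N%:R * (k * p)) + N%:R * (k * p) ^+ 2.
    transitivity (\sum_(T : tournament n) (Z T ^+ 2 - 2 * (k * p) * Z T + (k * p) ^+ 2)).
      by apply: eq_bigr => T _; ring.
    rewrite big_split sumrB -mulr_sumr SZ /= sumr_const; congr (_ + _).
    by rewrite -[LHS]mulr_natl.
  by nra.
rewrite -[X in _ <= X]mul1r ler_pdivlMr ?mulr_gt0//.
have kp0 : 0 < N%:R * (k * p) by rewrite !mulr_gt0.
rewrite -(ler_pM2l kp0) mulr1; apply: le_trans key.
by rewrite le_eqVlt; apply/orP; left; apply/eqP; ring.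
Qed.
End ScoreEvents.

(** * Binomial tails *)

Section BinomialEstimates.
Variable R : realType.
Local Notation b := (binom_pmf R).
Local Notation q := (binom_tail R).

Lemma binom_pmf_ge0 (M h : nat) : 0 <= b M h.
Proof. by rewrite divr_ge0 // exprn_ge0. Qed.

(** The ratio of consecutive terms, cross-multiplied; beyond [M] both sides vanish, so [h] is
    unrestricted. *)
Lemma binom_pmfS (M h : nat) : h.+1%:R * b M h.+1 = (M%:R - h%:R) * b M h.
Proof.
have [hM|Mh] := leqP h M; last by rewrite /binom_pmf !bin_small ?mul0r ?mulr0 // ltnW.
by rewrite /binom_pmf !mulrA -natrM mul_bin_left natrM natrB.
Qed.

(** The ratio (M - a) / (a + 1) is at most 1 as soon as M <= 2 a + 1. *)
Lemma binom_pmf_decr (M h k : nat) :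
  (M <= h.*2.+1)%N -> (h <= k)%N -> b M k <= b M h.
Proof.
move=> Mh /subnK <-; elim: (k - h)%N => [|i]; first by rewrite add0n.
rewrite addSn; apply: le_trans; set a := (i + h)%N.
have a1 : 0 < a.+1%:R :> R by rewrite ltr0n.
rewrite -(ler_pM2l a1) binom_pmfS ler_wpM2r ?binom_pmf_ge0 // lerBlDr -natrD ler_nat.
by rewrite /a; lia.
Qed.

Lemma binom_tail_nat (M k : nat) : q M k = \sum_(k <= a < M.+1) b M a.
Proof. by rewrite big_geq_mkord. Qed.

(* [(2 a - M) * b M a = a * b M a - (a + 1) * b M (a + 1)] telescopes. *)
Lemma binom_tail_le (M k : nat) :
  (M <= k.*2)%N -> q M k * (2 * k%:R - M%:R) <= k%:R * b M k.
Proof.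
move=> Mk; rewrite binom_tail_nat.
have [kM|Mk'] := leqP k M.+1; last first.
  by rewrite big_geq ?mul0r ?mulr_ge0 ?binom_pmf_ge0 // ltnW.
have tele : \sum_(k <= a < M.+1) (2 * a%:R - M%:R) * b M a = k%:R * b M k.
  transitivity (\sum_(k <= a < M.+1) - (a.+1%:R * b M a.+1 - a%:R * b M a)).
    by apply: eq_bigr => a _; rewrite binom_pmfS; ring.
  rewrite sumrN telescope_sumr // [b M M.+1]/binom_pmf bin_small //.
  by rewrite mul0r mulr0 sub0r opprK.
rewrite -tele mulr_suml !big_nat; apply: ler_sum => a /andP[ka _].
rewrite mulrC ler_wpM2r ?binom_pmf_ge0 // lerB // ler_pM2l // ler_nat //.
Qed.

(** The [k] terms at [h + 1], ..., [h + k] lie past the middle, so the last is the smallest; the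
    rest of the tail is dropped. *)
Lemma binom_tail_ge (M h k : nat) : (M <= h.*2.+1)%N -> (h + k <= M)%N ->
  k%:R * b M (h + k) <= q M h.+1.
Proof.
move=> Mh hkM; have hk1 : (h.+1 <= (h + k).+1)%N by rewrite ltnS leq_addr.
have hk2 : ((h + k).+1 <= M.+1)%N by [].
rewrite binom_tail_nat (big_cat_nat hk1 hk2) /=.
rewrite -[X in X <= _]addr0 lerD //; last by apply: sumr_ge0 => *; apply: binom_pmf_ge0.
apply: (@le_trans _ _ (\sum_(h.+1 <= a < (h + k).+1) b M (h + k))).
  by rewrite big_const_nat iter_addr_0 subSS addKn mulr_natl.
rewrite !big_nat; apply: ler_sum => a /andP[ha]; rewrite ltnS => ak.
by apply: binom_pmf_decr => //; lia.
Qed.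

(* [b M (h + 1) / b M h = 1 - (2 h + 1 - M) / (h + 1)], and the exponents
   [2 i + 1], i < j, add up to [j ^ 2]; similarly for the lower bound. *)
Lemma binom_pmf_upper (M j : nat) :
  b M (uphalf M + j) <=
  b M (uphalf M) * expR (- (j%:R ^+ 2 / (uphalf M + j)%:R)).
Proof.
set h0 := uphalf M.
have [->|j0] := posnP j; first by rewrite addn0 expr0n /= mul0r oppr0 expR0 mulr1.
have t0 : 0 < (h0 + j)%:R :> R by rewrite ltr0n addn_gt0 j0 orbT.
have Mh0 : (M <= h0.*2)%N by rewrite /h0; lia.
(* The denominator is frozen at [h0 + j], the largest of the [h + 1], so that the exponents add up
   along the induction. *)
suff step i : (i <= j)%N ->
    b M (h0 + i) <= b M h0 * expR (- (i%:R ^+ 2 / (h0 + j)%:R)) by exact: step.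
elim: i => [_|i IH ij]; first by rewrite addn0 expr0n /= mul0r oppr0 expR0 mulr1.
rewrite addnS; set h := (h0 + i)%N.
have h1 : 0 < h.+1%:R :> R by rewrite ltr0n.
apply: (@le_trans _ _ (b M h * expR (- (i.*2.+1%:R / (h0 + j)%:R)))); last first.
  apply: (@le_trans _ _ (b M h0 * expR (- (i%:R ^+ 2 / (h0 + j)%:R))
     * expR (- (i.*2.+1%:R / (h0 + j)%:R)))).
    by rewrite ler_wpM2r ?expR_ge0 // IH // ltnW.
  rewrite -mulrA -expRD le_eqVlt; apply/orP; left; apply/eqP; congr (_ * expR _).
  rewrite -[in RHS]natr1 -(natr1 i.*2) -mul2n natrM; field; by rewrite -natrD lt0r_neq0.
have -> : b M h.+1 = b M h * (1 - (h.*2.+1%:R - M%:R) / h.+1%:R).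
  apply: (mulfI (lt0r_neq0 h1)); rewrite binom_pmfS.
  rewrite -(natr1 h.*2) -mul2n natrM -natr1; field.
  by rewrite natr1 lt0r_neq0.
rewrite ler_wpM2l ?binom_pmf_ge0 //.
apply: (le_trans _ (expR_ge1Dx _)); rewrite lerD2l lerN2.
apply: (@le_trans _ _ (i.*2.+1%:R / h.+1%:R)).
  by rewrite ler_pM2l ?ltr0n // lef_pV2 ?posrE // ler_nat /h; lia.
rewrite ler_pM2r ?invr_gt0 // lerBrDr -natrD ler_nat /h; lia.
Qed.

Lemma binom_pmf_lower (M j : nat) : (j.*2 < M)%N ->
  b M M./2 <= expR (2 * j%:R ^+ 2 / (M%:R - 2 * j%:R)) * b M (M./2 + j).
Proof.
set h0 := M./2 => jM.
have D0 : 0 < M%:R - 2 * j%:R :> R.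
  by rewrite subr_gt0 -natrM ltr_nat; lia.
suff step i : (i <= j)%N ->
    b M h0 <= expR (2 * i%:R ^+ 2 / (M%:R - 2 * j%:R)) * b M (h0 + i) by exact: step.
elim: i => [_|i IH ij]; first by rewrite addn0 expr0n /= mulr0 mul0r expR0 mul1r.
rewrite addnS; set h := (h0 + i)%N.
have Mh : 0 < M%:R - h%:R :> R by rewrite subr_gt0 ltr_nat /h /h0; lia.
apply: (le_trans (IH (ltnW ij))); rewrite -/h.
have -> : 2 * i.+1%:R ^+ 2 / (M%:R - 2 * j%:R) = 2 * i%:R ^+ 2 / (M%:R - 2 * j%:R)
    + 2 * i.*2.+1%:R / (M%:R - 2 * j%:R) :> R.
  by rewrite -[in LHS]natr1 -(natr1 i.*2) -mul2n natrM; field; exact: lt0r_neq0.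
rewrite expRD -[X in _ <= X]mulrA ler_pM2l ?expR_gt0 //.
have -> : b M h = b M h.+1 * (1 + (h.*2.+1%:R - M%:R) / (M%:R - h%:R)).
  apply: (mulfI (lt0r_neq0 Mh)); rewrite -binom_pmfS.
  rewrite -(natr1 h.*2) -mul2n natrM -natr1; field.
  exact: lt0r_neq0.
rewrite mulrC ler_wpM2r ?binom_pmf_ge0 //.
apply: (le_trans (expR_ge1Dx _)); rewrite ler_expR.
rewrite ler_pdivrMr // mulrAC ler_pdivlMr //.
have e1 : h.*2.+1%:R - M%:R <= i.*2.+1%:R :> R.
  by rewrite lerBlDr -natrD ler_nat /h /h0; lia.
have e2 : M%:R - 2 * j%:R <= 2 * (M%:R - h%:R) :> R.
  have : (2 * h)%:R <= (M + 2 * j)%:R :> R by rewrite ler_nat /h /h0; lia.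
  by rewrite natrD !natrM; lra.
have e3 : 0 <= i.*2.+1%:R :> R by [].
nra.
Qed.

(** * Size of the central binomial probabilities *)

Lemma central_bin_double (c : nat) :
  'C(c.+1.*2, c.+1) = (2 * 'C(c.*2.+1, c.+1))%N.
Proof.
have e : 'C(c.*2.+1, c) = 'C(c.*2.+1, c.+1).
  by rewrite -[RHS]bin_sub; [congr ('C(_, _)); lia|lia].
rewrite doubleS binS e; lia.
Qed.

Lemma central_binomS (c : nat) :
  (c.+1 * 'C(c.+1.*2, c.+1) = 2 * (c.*2.+1 * 'C(c.*2, c)))%N.
Proof.
have e := mul_bin_diag c.*2.+1 c; rewrite /= in e.
rewrite central_bin_double; lia.
Qed.

Lemma central_pmfS (c : nat) :
  b c.+1.*2 c.+1 = (2 * c%:R + 1) / (2 * c%:R + 2) * b c.*2 c.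
Proof.
have c1 : 0 < c%:R + 1 :> R by rewrite natr1 ltr0n.
have := congr1 (fun k => k%:R : R) (central_binomS c); rewrite !natrM -natr1 => e.
apply: (mulfI (lt0r_neq0 c1)); rewrite /binom_pmf [LHS]mulrA e doubleS !exprS.
rewrite -(natr1 c.*2) -mul2n natrM; field.
by rewrite expf_neq0 //=; apply/andP; split=> //; apply: lt0r_neq0; lra.
Qed.

(** The left-hand side is 1 at [c = 0] and nonincreasing, since (2 c + 1) (2 c + 3) <= (2 c +
    2)^2. *)
Lemma central_pmf_upper (c : nat) : b c.*2 c ^+ 2 * (2 * c%:R + 1) <= 1.
Proof.
elim: c => [|c IH]; first by rewrite /binom_pmf bin0 expr0 divr1 mulr0 add0r expr1n mulr1.
apply: le_trans IH; rewrite central_pmfS exprMn -(natr1 c).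
set B := b _ _ ^+ 2; have B0 : 0 <= B by exact: sqr_ge0.
have c0 : 0 <= c%:R :> R by [].
set x : R := c%:R in c0 *.
have -> : ((2 * x + 1) / (2 * x + 2)) ^+ 2 * B * (2 * (x + 1) + 1) =
   B * ((2 * x + 1) * ((2 * x + 1) * (2 * x + 3) / (2 * x + 2) ^+ 2)).
  by field; apply: lt0r_neq0; lra.
rewrite ler_wpM2l // -[X in _ <= X]mulr1 ler_wpM2l //; first lra.
rewrite ler_pdivrMr ?mul1r; first nra.
by rewrite exprn_gt0 //; lra.
Qed.

(** The right-hand side is 1 at [c = 1] and nondecreasing, since (2 c + 1)^2 >= 4 c (c + 1). *)
Lemma central_pmf_lower (c : nat) : (0 < c)%N -> 1 <= b c.*2 c ^+ 2 * (4 * c%:R).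
Proof.
case: c => // c _; elim: c => [|c IH].
  by rewrite /binom_pmf /= (_ : 'C(2, 1) = 2%N) // ; lra.
apply: (le_trans IH); rewrite (central_pmfS c.+1) [X in _ <= X * _]exprMn -(natr1 c.+1).
set B := b _ _ ^+ 2; have B0 : 0 <= B by exact: sqr_ge0.
have c0 : 0 < c.+1%:R :> R by [].
set x : R := c.+1%:R in c0 *.
have -> : ((2 * x + 1) / (2 * x + 2)) ^+ 2 * B * (4 * (x + 1)) =
   B * ((2 * x + 1) ^+ 2 / (x + 1)).
  by field; apply/andP; split; apply: lt0r_neq0; lra.
rewrite ler_wpM2l // ler_pdivlMr; last lra.
nra.
Qed.

Lemma binom_pmf_half (M : nat) : b M M./2 = b M (uphalf M).
Proof.
by rewrite /binom_pmf -[in LHS]bin_sub ?leq_half //; [congr ('C(_, _)%:R / _)|]; lia.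
Qed.

(** For odd [M], one more trial doubles both the coefficient and the power of 2; this reduces the
    center to an even number of trials. *)
Lemma binom_pmf_uphalf (M : nat) : b M (uphalf M) = b (uphalf M).*2 (uphalf M).
Proof.
set c := uphalf M; have [oM|eM] := boolP (odd M); last by rewrite (_ : c.*2 = M) // /c; lia.
case E : c => [|c']; first by move: oM E; rewrite /c; lia.
have -> : M = c'.*2.+1 by move: oM E; rewrite /c; lia.
have p0 : 2 ^+ c'.*2.+1 != 0 :> R by rewrite expf_neq0.
rewrite /binom_pmf doubleS (exprS _ c'.*2.+1).
by rewrite -doubleS central_bin_double natrM; field.
Qed.

Lemma binom_pmf_center_upper (M : nat) : (0 < M)%N -> b M (uphalf M) ^+ 2 <= M%:R^-1.
Proof.
move=> M0; have M0' : 0 < M%:R :> R by rewrite ltr0n.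
rewrite -[X in _ <= X]mul1r ler_pdivlMr // binom_pmf_uphalf.
apply: (le_trans _ (central_pmf_upper (uphalf M))); rewrite ler_wpM2l ?sqr_ge0 //.
by rewrite -natrM natr1 ler_nat; lia.
Qed.

Lemma binom_pmf_center_lower (M : nat) : (0 < M)%N ->
  (4 * M%:R)^-1 <= b M M./2 ^+ 2.
Proof.
move=> M0; have M0' : 0 < M%:R :> R by rewrite ltr0n.
rewrite -[X in X <= _]mul1r ler_pdivrMr ?mulr_gt0 // binom_pmf_half binom_pmf_uphalf.
apply: (le_trans (central_pmf_lower (_ : 0 < uphalf M)%N)); first lia.
by rewrite ler_wpM2l ?sqr_ge0 // ler_pM2l // ler_nat; lia.
Qed.
End BinomialEstimates.

(* Here [s] stands for the square root of [n - 1]. *)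
Section RealEstimates.
Variables (R : realType) (x s : R).

(** Consequences listed monomial by monomial, so that linear arithmetic can treat [x * s] and
    [s ^+ 2] as atoms. *)
Lemma scale_bounds : 1 <= x -> 1000 * x ^+ 4 <= s ->
  [/\ 0 < x, 0 < s & 1000 <= s] /\
  [/\ 1000 * x <= s, 1000 * x ^+ 3 <= s, s <= x * s, 1000 * s <= s ^+ 2
    & 1000 * (x * s) <= s ^+ 2].
Proof.
move=> x1 xs; have x2 : x <= x ^+ 4 by rewrite -[X in X <= _]expr1 ler_weXn2l.
have x4 : x ^+ 3 <= x ^+ 4 by rewrite ler_weXn2l.
have s1 : 1000 <= s by lra.
have s2 : 1000 * x <= s by lra.
have s3 : 1000 * x ^+ 3 <= s by lra.
have s0 : 0 <= s by lra.
split; split=> //; rewrite ?(expr2 s); [lra|lra|by rewrite ler_peMl| |].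
- by rewrite ler_wpM2r.
- by rewrite mulrA ler_wpM2r.
Qed.

(** With [j] about x s / 2 and [T] about s^2 / 2, the quotient is x^2 up to an error of order x^3 /
    s, which the 1 absorbs. *)
Lemma upper_exponent (j T : R) : 1 <= x -> 1000 * x ^+ 4 <= s ->
  x * s / 2 - 1 <= j -> 0 < T -> T <= s ^+ 2 / 2 + x * s / 2 ->
  x ^+ 2 - 1 <= 2 * (j ^+ 2 / T).
Proof.
move=> x1 xs; have [[x0 s0 s_ge] [xs1 xs3 sxs ss xss]] := scale_bounds x1 xs.
move=> hj T0 hT; rewrite mulrA ler_pdivlMr //.
have y1 : 0 <= x * s / 2 - 1 by clear -s_ge sxs; lra.
have j2 : (x * s / 2 - 1) ^+ 2 <= j ^+ 2.
  by rewrite ler_pXn2r ?nnegrE // (le_trans y1).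
apply: (@le_trans _ _ ((x ^+ 2 - 1) * (s ^+ 2 / 2 + x * s / 2))).
  by rewrite ler_wpM2l // subr_ge0 exprn_ege1.
apply: (@le_trans _ _ (2 * (x * s / 2 - 1) ^+ 2)); last by rewrite ler_pM2l.
rewrite -subr_ge0.
have -> : 2 * (x * s / 2 - 1) ^+ 2 - (x ^+ 2 - 1) * (s ^+ 2 / 2 + x * s / 2) =
  s / 2 * (s - 3 * x - x ^+ 3) + 2 by field.
have h : 0 <= s - 3 * x - x ^+ 3 by clear -xs1 xs3 s0; lra.
by rewrite addr_ge0 // mulr_ge0 // divr_ge0 // ltW.
Qed.

(** The window [k <= s / x] keeps the cross term x s k of j^2 below s^2, so it shifts the exponent
    only by a constant; 8 is generous. *)
Lemma lower_exponent (j k : R) : 1 <= x -> 1000 * x ^+ 4 <= s ->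
  0 <= j -> j <= x * s / 2 + k + 2 -> k <= s / x ->
  0 < s ^+ 2 - 1 - 2 * j /\
  2 * j ^+ 2 / (s ^+ 2 - 1 - 2 * j) <= x ^+ 2 / 2 + 8.
Proof.
move=> x1 xs; have [[x0 s0 s_ge] [xs1 xs3 sxs ss xss]] := scale_bounds x1 xs.
move=> j0 hj; set z := s / x => hk.
have xz : x * z = s by rewrite mulrCA divff ?mulr1// gt_eqF.
have z0 : 0 <= z by rewrite divr_ge0 // ltW.
have zs : z <= s by rewrite -xz ler_peMl.
have jz : j <= x * s / 2 + z + 2 by clear -hj hk; lra.
have D : s ^+ 2 - 8 * (x * s) <= s ^+ 2 - 1 - 2 * j.
  by clear -jz zs s_ge sxs; lra.
have D0 : 0 < s ^+ 2 - 8 * (x * s) by clear -xss sxs s_ge; lra.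
have D1 := lt_le_trans D0 D.
split=> //; rewrite ler_pdivrMr //.
apply: (@le_trans _ _ ((x ^+ 2 / 2 + 8) * (s ^+ 2 - 8 * (x * s)))); last first.
  by rewrite ler_wpM2l // addr_ge0 // divr_ge0 // sqr_ge0.
have j2 : j ^+ 2 <= (x * s / 2 + z + 2) ^+ 2.
  by rewrite ler_pXn2r ?nnegrE // (le_trans j0).
have e : (x * s / 2 + z + 2) ^+ 2 = (x * s) ^+ 2 / 4 + s ^+ 2 + z ^+ 2
    + 2 * (x * s) + 4 * z + 4.
  by rewrite (_ : s ^+ 2 = s * (x * z)); [field|rewrite xz expr2].
have z2 : z ^+ 2 <= s ^+ 2 by rewrite ler_pXn2r ?nnegrE // ltW.
have j3 : j ^+ 2 <= (x * s) ^+ 2 / 4 + 3 * s ^+ 2.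
  apply: (le_trans j2); rewrite e; move: ((x * s) ^+ 2) z2 => u z2.
  by clear -z2 xss zs ss s_ge; lra.
have e' : (x ^+ 2 / 2 + 8) * (s ^+ 2 - 8 * (x * s)) = (x * s) ^+ 2 / 2
   + 8 * s ^+ 2 - 4 * (x ^+ 3 * s) - 64 * (x * s) by field.
have x3s : 1000 * (x ^+ 3 * s) <= s ^+ 2 by rewrite mulrA expr2 ler_wpM2r // ltW.
rewrite e'; move: ((x * s) ^+ 2) j3 (x ^+ 3 * s) x3s => u j3 v x3s.
by clear -j3 x3s xss ss s_ge; lra.
Qed.
End RealEstimates.

(** * Tie probabilities and score tails near the threshold *)

Section Tails.
Variables (R : realType) (n : nat) (x s : R).
Local Notation M := n.-2.
Local Notation b := (binom_pmf R M).
Local Notation q := (binom_tail R M).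

Lemma size_bounds : 1 <= x -> 1000 * x ^+ 4 <= s -> s ^+ 2 = n.-1%:R ->
  [/\ n%:R = s ^+ 2 + 1 :> R, M%:R = s ^+ 2 - 1 :> R & (0 < M)%N].
Proof.
move=> x1 xs s2; have [[x0 s0 s_ge] [xs1 xs3 sxs ss xss]] := scale_bounds x1 xs.
have n3 : (3 < n.-1)%N by rewrite -(ltr_nat R) -s2; clear -ss s_ge; lra.
split; last by clear -n3; lia.
  by rewrite s2 natr1; congr _%:R; clear -n3; lia.
by apply: (addIr 1); rewrite subrK s2 natr1; congr _%:R; clear -n3; lia.
Qed.

(** [T] is the threshold minus one, as a score of at least [t] exceeds [t - 1]. The 16 is the
    product of 4 from [n2], 2 from [qT] and 2 from [bT]. *)
Lemma tie_tail_le (T : nat) : 1 <= x -> 1000 * x ^+ 4 <= s -> s ^+ 2 = n.-1%:R ->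
  s ^+ 2 / 2 - 1 + x * s / 2 <= T%:R -> T%:R <= s ^+ 2 / 2 + x * s / 2 ->
  n%:R ^+ 2 * \sum_(a < M.+1 | (T <= a)%N) b a * b a.+1
  <= 16 * s ^+ 3 * expR (1 - x ^+ 2).
Proof.
move=> x1 xs s2; have [[x0 s0 s_ge] [xs1 xs3 sxs ss xss]] := scale_bounds x1 xs.
have [nE ME M0] := size_bounds x1 xs s2.
move=> T1 T2.
have MT : (M <= T.*2)%N.
  by rewrite -(ler_nat R) -mul2n natrM ME; clear -T1 sxs s_ge; lra.
have hT : (uphalf M <= T)%N by clear -MT; lia.
have T0 : 0 < T%:R :> R by clear -T1 sxs s_ge ss; lra.
pose j := (T - uphalf M)%N.
have jT : (uphalf M + j)%N = T by rewrite subnKC.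
have hj : x * s / 2 - 1 <= j%:R.
  rewrite natrB // lerBrDr.
  have : (2 * uphalf M)%:R <= (M + 1)%:R :> R by rewrite ler_nat; clear; lia.
  by rewrite natrD natrM ME => h; clear -h T1; lra.
have s20 : 0 < s ^+ 2 by rewrite exprn_gt0.
have bT : b T ^+ 2 <= 2 / s ^+ 2 * expR (1 - x ^+ 2).
  have := binom_pmf_upper R M j; rewrite jT => bu.
  apply: (@le_trans _ _ ((b (uphalf M) * expR (- (j%:R ^+ 2 / T%:R))) ^+ 2)).
    by rewrite ler_pXn2r ?nnegrE ?mulr_ge0 ?expR_ge0 ?binom_pmf_ge0.
  rewrite exprMn ler_pM ?sqr_ge0 //.
    apply: (le_trans (binom_pmf_center_upper R M0)).
    rewrite -[M%:R^-1]mul1r ler_pdivrMr ?ltr0n // mulrAC ler_pdivlMr // ME.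
    by clear -ss s_ge; lra.
  rewrite -expRM_natl ler_expR mulrN -mulr_natl.
  by have h := upper_exponent x1 xs hj T0 T2; clear -h; lra.
(* The gap is really about [x * s]; giving up the factor [x] is affordable here. *)
have den : s / 2 <= 2 * T%:R - M%:R.
  by rewrite ME; clear -T1 s_ge sxs; lra.
have qT : q T <= 2 * s * b T.
  have sh : 0 < s / 2 by rewrite divr_gt0.
  rewrite -(ler_pM2r sh).
  apply: (@le_trans _ _ (q T * (2 * T%:R - M%:R))).
    by rewrite ler_wpM2l // sumr_ge0 // => *; exact: binom_pmf_ge0.
  apply: (le_trans (binom_tail_le R MT)).
  have -> : 2 * s * b T * (s / 2) = s ^+ 2 * b T by field.
  by rewrite ler_wpM2r ?binom_pmf_ge0 //; clear -T2 xss s20; lra.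
have sumT : \sum_(a < M.+1 | (T <= a)%N) b a * b a.+1 <= 2 * s * b T ^+ 2.
  apply: (@le_trans _ _ (q T * b T)).
    rewrite mulr_suml; apply: ler_sum => a Ta.
    by rewrite ler_wpM2l ?binom_pmf_ge0 // binom_pmf_decr //; clear -MT Ta; lia.
  by rewrite expr2 mulrA ler_wpM2r ?binom_pmf_ge0.
have n2 : n%:R ^+ 2 <= 4 * s ^+ 4.
  have -> : 4 * s ^+ 4 = (2 * s ^+ 2) ^+ 2 by ring.
  have h : n%:R <= 2 * s ^+ 2 by rewrite nE; clear -ss s_ge; lra.
  by rewrite ler_pXn2r ?nnegrE // (le_trans _ h).
apply: (@le_trans _ _ (4 * s ^+ 4 * (2 * s * (2 / s ^+ 2 * expR (1 - x ^+ 2))))).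
  apply: ler_pM => //.
    by apply: sumr_ge0 => a _; rewrite mulr_ge0 ?binom_pmf_ge0.
  by apply: (le_trans sumT); rewrite ler_wpM2l // mulr_ge0 // ltW.
move: (expR _) => w; rewrite le_eqVlt; apply/orP; left; apply/eqP.
by clear -s0; field; exact: lt0r_neq0.
Qed.

(** At least s / (2 x) terms follow [t], each at least exp (- x^2 / 2 - 8) / (2 s), and n >= s^2. *)
Lemma score_tail_ge (t : nat) : 1 <= x -> 1000 * x ^+ 4 <= s -> s ^+ 2 = n.-1%:R ->
  s ^+ 2 / 2 + x * s / 2 <= t%:R -> t%:R <= s ^+ 2 / 2 + x * s / 2 + 1 ->
  s ^+ 2 / (4 * x) * expR (- (x ^+ 2 / 2) - 8) <= n%:R * q t.+1.
Proof.
move=> x1 xs s2; have [[x0 s0 s_ge] [xs1 xs3 sxs ss xss]] := scale_bounds x1 xs.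
have [nE ME M0] := size_bounds x1 xs s2.
move=> t1 t2.
have zx : 1000 <= s / x by rewrite ler_pdivlMr.
(* The longest window that [lower_exponent] allows; as s / x >= 1000, rounding loses less than half
   of it. *)
pose k := Num.truncn (s / x).
have /andP[k1 k2] : (k%:R <= s / x < k.+1%:R).
  by apply: truncn_itv; rewrite divr_ge0 // ltW.
have k3 : s / (2 * x) <= k%:R.
  have -> : s / (2 * x) = s / x / 2 by clear -x0; field; exact: lt0r_neq0.
  by rewrite -natr1 in k2; clear -zx k2; lra.
pose j := (t + k - M./2)%N.
have hM : (M./2 <= t + k)%N.
  rewrite -(ler_nat R) natrD.
  have : (2 * M./2)%:R <= M%:R :> R by rewrite ler_nat; clear; lia.
  have k0 : 0 <= k%:R :> R by [].
  by rewrite natrM ME => h; clear -h t1 sxs s_ge k0; lra.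
have jE : (M./2 + j)%N = (t + k)%N by rewrite subnKC.
have hj : j%:R <= x * s / 2 + k%:R + 2.
  rewrite natrB // natrD.
  have : M%:R <= (2 * M./2 + 1)%:R :> R by rewrite ler_nat; clear; lia.
  by rewrite natrD natrM ME => h; clear -h t2; lra.
have [D0 hE] := lower_exponent x1 xs (ler0n _ _) hj k1.
rewrite -ME in D0 hE.
have jM : (j.*2 < M)%N.
  by rewrite -(ltr_nat R) -mul2n natrM -subr_gt0.
have bl := binom_pmf_lower R jM; rewrite jE in bl.
have s2' : 0 < 2 * s by rewrite mulr_gt0.
have bc : (2 * s)^-1 <= b M./2.
  rewrite -(@ler_pXn2r _ 2) ?nnegrE ?binom_pmf_ge0 ?invr_ge0 ?(ltW s2') //.
  apply: le_trans (binom_pmf_center_lower R M0).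
  rewrite exprVn lef_pV2 ?posrE ?exprn_gt0 ?mulr_gt0 ?ltr0n // ME.
  by rewrite exprMn; clear -s0; lra.
have btk : (2 * s)^-1 * expR (- (x ^+ 2 / 2) - 8) <= b (t + k).
  apply: (@le_trans _ _ (expR (2 * j%:R ^+ 2 / (M%:R - 2 * j%:R)) * b (t + k)
     * expR (- (x ^+ 2 / 2) - 8))).
    by rewrite ler_wpM2r ?expR_ge0 // (le_trans bc).
  rewrite mulrAC -expRD -[X in _ <= X]mul1r ler_wpM2r ?binom_pmf_ge0 //.
  rewrite expR_le1; move: (_ / (M%:R - _)) hE => E hE.
  by clear -hE; lra.
have tM : (M <= t.*2.+1)%N.
  by apply: leqW; rewrite -(ler_nat R) -mul2n natrM ME; clear -t1 sxs s_ge; lra.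
have tkM : (t + k <= M)%N by rewrite -jE; clear -jM; lia.
have qt := binom_tail_ge R tM tkM.
apply: (@le_trans _ _
  (s ^+ 2 * (s / (2 * x) * ((2 * s)^-1 * expR (- (x ^+ 2 / 2) - 8))))).
  move: (expR _) => w; rewrite le_eqVlt; apply/orP; left; apply/eqP.
  by clear -x0 s0; field; rewrite !lt0r_neq0.
apply: ler_pM; rewrite ?sqr_ge0 //.
- by rewrite !mulr_ge0 ?invr_ge0 ?expR_ge0 ?mulr_ge0 ?ltW.
- by rewrite nE lerDl.
apply: le_trans qt; apply: ler_pM => //.
- by rewrite divr_ge0 ?mulr_ge0 // ltW.
- by rewrite mulr_ge0 ?invr_ge0 ?expR_ge0 // ltW.
Qed.
End Tails.

(** * Asymptotics *)

Section Asymptotics.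
Variables (R : realType) (eps : R).

(* The threshold [1000 * 864] on [L] yields
   [1000 * x ^+ 4 <= 4000 * L ^+ 2 <= L ^+ 3 / 216 <= sqrt m]; it is kept as a
   product because numerals are unary here. *)
Lemma x_bounds (m : nat) (L := ln m%:R : R) : 0 < eps -> eps < 1 -> 1000 * 864 <= L ->
  [/\ x_ eps m ^+ 2 = 2 * L - (1 + eps) * ln L, 1 <= x_ eps m,
      0 <= ln L & x_ eps m ^+ 2 <= 2 * L].
Proof.
move=> e0 e1 hL; have L0 : 0 < L by clear -hL; lra.
have lnL0 : 0 <= ln L by apply: ln_ge0; clear -hL; lra.
have lnL : ln L <= L / 2.
  have l2 : ln 2 <= 1 :> R by rewrite (_ : 2 = 1 + 1) // le_ln1Dx // (lt_trans (ltrN10 _)).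
  have lL : ln (L / 2) <= L / 2 - 1.
    rewrite -[X in ln X](subrK 1) addrC le_ln1Dx //; clear -L0; lra.
  have -> : ln L = ln 2 + ln (L / 2).
    by rewrite -lnM ?posrE ?divr_gt0 // mulrCA divff // mulr1.
  by clear -l2 lL; lra.
have x2 : L <= 2 * L - (1 + eps) * ln L.
  have : (1 + eps) * ln L <= 2 * (L / 2) by apply: ler_pM => //; clear -e0 e1; lra.
  by clear; lra.
have x2E : x_ eps m ^+ 2 = 2 * L - (1 + eps) * ln L.
  by rewrite sqr_sqrtr // (le_trans _ x2) // ltW.
split=> //.
- rewrite -(@ler_pXn2r _ 2) ?nnegrE ?sqrtr_ge0 // x2E expr1n.
  by apply: le_trans x2; clear -hL; lra.
- by rewrite x2E gerBl mulr_ge0 // addr_ge0 // ltW.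
Qed.

(** The cubic bound comes from s = exp (L / 6)^3 and exp y >= 1 + y. *)
Lemma sqrt_bounds (m : nat) (L := ln m%:R : R) (s := Num.sqrt m%:R : R) : 0 < L ->
  [/\ s ^+ 2 = m%:R, s = expR (L / 2) & L ^+ 3 / 216 <= s].
Proof.
move=> L0; have m0 : 0 < m%:R :> R.
  by rewrite ltr0n lt0n; apply: contraTneq L0 => m0; rewrite /L m0 ln0 // ltxx.
have sE : s = expR (L / 2).
  apply/eqP; rewrite -(@eqrXn2 _ 2) ?sqrtr_ge0 ?expR_ge0 // sqr_sqrtr // -expRM_natl.
  by rewrite mulrCA divff // mulr1 lnK.
split=> //; first by rewrite sqr_sqrtr.
have -> : L ^+ 3 / 216 = (L / 6) ^+ 3 by field.
have -> : s = expR (L / 6) ^+ 3 by rewrite sE -expRM_natl; congr expR; field.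
have h := expR_ge1Dx (L / 6).
have L6 : 0 <= L / 6 by rewrite divr_ge0 // ltW.
rewrite ler_pXn2r ?nnegrE ?expR_ge0 //.
by apply: le_trans h; rewrite lerDr.
Qed.

Lemma x4_le (m : nat) (L := ln m%:R : R) : 0 < eps -> eps < 1 -> 1000 * 864 <= L ->
  1000 * x_ eps m ^+ 4 <= Num.sqrt m%:R.
Proof.
move=> e0 e1 hL; have L0 : 0 < L by clear -hL; lra.
have [_ _ _ x2] := x_bounds e0 e1 hL; have [_ _ h3] := sqrt_bounds L0.
apply: le_trans h3; have -> : x_ eps m ^+ 4 = (x_ eps m ^+ 2) ^+ 2 by ring.
apply: (@le_trans _ _ (1000 * (2 * L) ^+ 2)).
  by rewrite ler_wpM2l ?ler0n // ler_pXn2r ?nnegrE ?sqr_ge0 ?mulr_ge0 ?(ltW L0).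
have -> : 1000 * (2 * L) ^+ 2 = 1000 * 864 * (L ^+ 2 / 216) by field.
have -> : L ^+ 3 / 216 = L * (L ^+ 2 / 216) by field.
by apply: ler_wpM2r hL; rewrite divr_ge0 ?sqr_ge0 ?ler0n.
Qed.

(** The ceiling of a nonnegative real is a natural number, so comparisons with the threshold can be
    moved from integers to [nat]. *)
Lemma t_bounds (m : nat) (s := Num.sqrt m%:R : R) : exists2 t : nat, t_ eps m = t%:Z &
  s ^+ 2 / 2 + x_ eps m * s / 2 <= t%:R /\
  t%:R < s ^+ 2 / 2 + x_ eps m * s / 2 + 1.
Proof.
have e : m%:R / 2 + x_ eps m * Num.sqrt (m%:R / 4) = s ^+ 2 / 2 + x_ eps m * s / 2.
  rewrite sqr_sqrtr // sqrtrM // -mulrA -/s; congr (_ + _ * (_ * _)).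
  have -> : 4^-1 = 2^-1 ^+ 2 :> R by field.
  by rewrite sqrtr_sqr ger0_norm.
have z0 : 0 <= s ^+ 2 / 2 + x_ eps m * s / 2.
  by rewrite addr_ge0 ?divr_ge0 ?sqr_ge0 ?mulr_ge0 ?sqrtr_ge0.
have /andP[h1 h2] := ceil_itv (s ^+ 2 / 2 + x_ eps m * s / 2).
have : 0 <= t_ eps m by rewrite /t_ e ceil_ge0 (lt_le_trans _ z0).
rewrite /t_ e in h1 h2 *; case: (Num.ceil _) h1 h2 => // t h1 h2 _; exists t => //.
by split=> //; move: h1; rewrite intrD ltrBlDr.
Qed.

(** By s^2 = exp L and the choice of x, s^2 exp (- x^2 / 2) is L^((1 + eps) / 2). Dividing by 4 x <=
    8 sqrt L leaves L^(eps / 2) / 8, up to the factor exp (- 8). *)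
Lemma Pr_max_le (n : nat) (L := ln n.-1%:R : R) : 0 < eps -> eps < 1 -> 1000 * 864 <= L ->
  Pr R (fun T : tournament n => ~~ (t_ eps n.-1 < (max_score T)%:Z))
  <= 8 * expR 8 / expR (eps / 2 * ln L).
Proof.
move=> e0 e1 hL; have L0 : 0 < L by clear -hL; lra.
have [x2E x1 lnL0 x2] := x_bounds e0 e1 hL.
have [s2 sE _] := sqrt_bounds L0; have x4 := x4_le e0 e1 hL.
have [t tE [t1 t2]] := t_bounds n.-1.
have [_ _ M0] := size_bounds x1 x4 s2.
have n1 : (1 < n)%N by clear -M0; lia.
have := score_tail_ge x1 x4 s2 t1 (ltW t2).
set s := Num.sqrt _ in s2 sE x4 t1 t2 *; set x := x_ eps _ in x2E x1 x2 x4 t1 t2 *.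
set q := binom_tail R n.-2 => hq.
have x0 : 0 < x by apply: lt_le_trans x1.
pose u := expR (ln L / 2); have u0 : 0 < u by exact: expR_gt0.
have uL : u ^+ 2 = L by rewrite -expRM_natl mulrCA divff // mulr1 lnK.
have xu : x <= 2 * u.
  rewrite -(@ler_pXn2r _ 2) ?nnegrE ?mulr_ge0 ?(ltW x0) ?(ltW u0) //.
  rewrite exprMn uL; apply: (le_trans x2); rewrite ler_pM2r //; clear; lra.
pose w : R := expR 8; have w0 : 0 < w by exact: expR_gt0.
have low : expR (eps / 2 * ln L) / (8 * w) <= n%:R * q t.+1.
  apply: le_trans hq; rewrite x2E.
  have -> : - ((2 * L - (1 + eps) * ln L) / 2) - 8 =
      - L + ln L / 2 + eps / 2 * ln L - 8 by field.
  rewrite !expRD -/u expRN.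
  have -> : s ^+ 2 = expR L by rewrite sE -expRM_natl mulrCA divff // mulr1.
  rewrite (expRN 8) -/w; move: (expR L) (expR_gt0 L)
    (expR (eps / 2 * _)) (expR_gt0 (eps / 2 * ln L)) => a a0 c c0.
  have -> : a / (4 * x) * (a^-1 * u * c * w^-1) = c / (8 * w) * (2 * u / x).
    by clear -a0 w0 x0; field; rewrite !lt0r_neq0.
  apply: ler_peMr; first by rewrite divr_ge0 ?mulr_ge0 // ltW.
  by rewrite ler_pdivlMr // mul1r.
pose p := (q t + q t.+1) / 2.
have qq : q t.+1 <= q t.
  rewrite /q /binom_tail [X in X <= _]big_mkcond [X in _ <= X]big_mkcond /=.
  apply: ler_sum => a _; have [ta|ta] := ltnP t a; first by rewrite ltnW.
  by case: ifP => // _; exact: binom_pmf_ge0.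
have qp : q t.+1 <= p by rewrite /p; clear -qq; lra.
have low' : expR (eps / 2 * ln L) / (8 * w) <= n%:R * p.
  by apply: (le_trans low); rewrite ler_wpM2l.
have pos : 0 < expR (eps / 2 * ln L) / (8 * w).
  by rewrite divr_gt0 ?mulr_gt0 ?expR_gt0.
have p0 : 0 < p.
  by have := lt_le_trans pos low'; rewrite pmulr_rgt0 // ltr0n ltnW.
apply: (@le_trans _ _ (n%:R * p)^-1); last first.
  by rewrite -[X in _ <= X]invrK invf_div lef_pV2 // posrE (lt_le_trans pos).
have -> : (fun T : tournament n => ~~ (t_ eps n.-1 < (max_score T)%:Z)) =
    (fun T => ~~ [exists i, (t < score T i)%N]).
  apply/funext => T; rewrite tE ltz_nat; congr (~~ _).
  apply/idP/existsP => [|[i ti]]; last by rewrite (leq_trans ti) // leq_bigmax.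
  rewrite ltnNge => /negP h; apply: contrapT => nex; apply: h.
  by apply/bigmax_leqP => i _; rewrite leqNgt; apply/negP => ti; apply: nex; exists i.
rewrite -[n in n%:R]card_ord.
apply: (@Pr_none_le _ _ _ (fun i T => (t < score T i)%N)) => //.
- by rewrite card_ord ltnW.
- by move=> i; rewrite Pr_score_gt.
(* Negative correlation is the inequality between geometric and arithmetic means. *)
- move=> i j ij; rewrite Pr_score_gt2 // -/q /p.
  have := sqr_ge0 (q t - q t.+1); move: (q t) (q t.+1) => a c; clear; nra.
Qed.

(** Since exp (2 L) = s^4 and L^(1 + eps) <= L^2, the bound of [tie_tail_le] is at most 16 e L^2 /
    s, and s >= L^3 / 216. *)
Lemma Pr_ties_le (n : nat) (L := ln n.-1%:R : R) : 0 < eps -> eps < 1 -> 1000 * 864 <= L ->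
  Pr R (fun T : tournament n => (0 < num_ties (t_ eps n.-1) T)%N)
  <= 16 * 216 * expR 1 / L.
Proof.
move=> e0 e1 hL; have L0 : 0 < L by clear -hL; lra.
have [x2E x1 lnL0 x2] := x_bounds e0 e1 hL.
have [s2 sE s3] := sqrt_bounds L0; have x4 := x4_le e0 e1 hL.
have [t tE [t1 t2]] := t_bounds n.-1.
set s := Num.sqrt _ in s2 sE s3 x4 t1 t2 *; set x := x_ eps _ in x2E x1 x2 x4 t1 t2 *.
have [[x0 s0 s_ge] [_ _ sxs ss _]] := scale_bounds x1 x4.
(* The threshold is positive, hence a successor [T.+1]. *)
case: t tE t1 t2 => [|T] tE t1 t2; first by exfalso; clear -t1 s_ge sxs ss; lra.
have T1 : s ^+ 2 / 2 - 1 + x * s / 2 <= T%:R by rewrite -(natr1 T) in t1; clear -t1; lra.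
have T2 : T%:R <= s ^+ 2 / 2 + x * s / 2 by rewrite -(natr1 T) in t2; clear -t2; lra.
have := tie_tail_le x1 x4 s2 T1 T2; set S := \sum_(a < _ | _) _ => hS.
have S0 : 0 <= S by apply: sumr_ge0 => a _; rewrite mulr_ge0 ?binom_pmf_ge0.
apply: (@le_trans _ _ (n%:R ^+ 2 * S)); last first.
  apply: (le_trans hS).
  have -> : 1 - x ^+ 2 = 1 - 2 * L + (1 + eps) * ln L by rewrite x2E -/L; ring.
  have h1 : expR ((1 + eps) * ln L) <= L ^+ 2.
    rewrite -[X in X ^+ 2]lnK // -expRM_natl ler_expR ler_wpM2r //; clear -e1; lra.
  have sL : expR (2 * L) = s ^+ 4 by rewrite sE -/L -expRM_natl; congr expR; field.
  rewrite !expRD expRN sL.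
  apply: (@le_trans _ _ (16 * s ^+ 3 * (expR 1 / s ^+ 4 * L ^+ 2))).
    rewrite ler_wpM2l ?mulr_ge0 ?exprn_ge0 ?(ltW s0) // ler_wpM2l //.
    by rewrite divr_ge0 ?expR_ge0 ?exprn_ge0 ?(ltW s0).
  have -> : 16 * s ^+ 3 * (expR 1 / s ^+ 4 * L ^+ 2) = 16 * expR 1 * L ^+ 2 / s.
    by move: (expR 1) => w; clear -s0; field; exact: lt0r_neq0.
  rewrite ler_pdivrMr //.
  apply: (@le_trans _ _ (16 * 216 * expR 1 / L * (L ^+ 3 / 216))).
    rewrite le_eqVlt; apply/orP; left; apply/eqP.
    by move: (expR 1) => w; clear -L0; field; exact: lt0r_neq0.
  have c0 : 0 <= 16 * 216 * expR 1 / L.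
    apply: divr_ge0; last exact: ltW.
    by apply: mulr_ge0; [rewrite -natrM ler0n|exact: expR_ge0].
  exact: (ler_wpM2l c0 s3).
pose F (uv : 'I_n * 'I_n) (T' : tournament n) :=
  (uv.1 != uv.2) && ((score T' uv.1 == score T' uv.2) && (T < score T' uv.1)%N).
apply: (@le_trans _ _ (\sum_uv Pr R (F uv))).
  apply: Pr_le_sum => T' /card_gt0P[uv]; rewrite finset.in_set => /andP[uvn].
  move=> /existsP[h /and3P[th /eqP hu /eqP hv]]; exists uv; rewrite /F uvn hu hv eqxx /=.
  by move: th; rewrite tE lez_nat.
have -> : n%:R ^+ 2 * S = \sum_(uv : 'I_n * 'I_n) S.
  by rewrite sumr_const -[RHS]mulr_natl card_prod card_ord natrM expr2.
apply: ler_sum => -[u v] _; rewrite /F /=.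
have [->|uv] := eqVneq u v; last by rewrite Pr_tie.
by rewrite PrE big1 ?mul0r.
Qed.


(** Turns explicit bounds in terms of [ln n.-1] into limits: n >= exp K + 1 suffices for
    [K <= ln n.-1]. *)
Lemma cvg_to0_ln (f : nat -> R) : (forall n, 0 <= f n) ->
  (forall e : R, 0 < e -> exists K : R, forall n : nat, K <= ln (n.-1%:R : R) -> f n <= e) ->
  f @ \oo --> (0 : R).
Proof.
move=> f0 fe; apply/cvgr0Pnorm_le => e /fe[K hK].
have ln_ge (n : nat) : expR K + 1 <= n%:R -> K <= ln (n.-1%:R : R).
  case: n => [|n] h; first by have := expR_gt0 K; lra.
  have hn : expR K <= n%:R by rewrite -(natr1 n) lerD2r in h.
  by rewrite -[K]expRK ler_ln ?posrE ?expR_gt0 // (lt_le_trans (expR_gt0 K)).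
near=> n; rewrite ger0_norm //; apply/hK/ln_ge.
by near: n; exact: nbhs_infty_ger.
Unshelve. all: end_near. Qed.

Lemma Pr_max_cvg : 0 < eps -> eps < 1 ->
  (fun n : nat => Pr R (fun T : tournament n => ~~ (t_ eps n.-1 < (max_score T)%:Z)))
    @ \oo --> (0 : R).
Proof.
move=> e0 e1; apply: cvg_to0_ln => [n|e e_gt0]; first exact: Pr_ge0.
pose C : R := 8 * expR 8.
have C0 : 0 < C by rewrite mulr_gt0 ?expR_gt0.
(* The second entry makes eps / 2 * ln L at least C / e, and exp y >= y then gives C / exp (eps / 2
   * ln L) <= e. *)
exists (Num.max (1000 * 864) (expR (2 * C / (eps * e)))) => n.
rewrite ge_max => /andP[h1 h2]; apply: (le_trans (Pr_max_le e0 e1 h1)); rewrite -/C.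
have L0 : 0 < ln n.-1%:R :> R by apply: lt_le_trans h2; exact: expR_gt0.
have h3 : 2 * C / (eps * e) <= ln (ln n.-1%:R).
  by rewrite -[X in X <= _]expRK ler_ln ?posrE ?expR_gt0.
have h4 := expR_ge1Dx (eps / 2 * ln (ln n.-1%:R)).
rewrite ler_pdivrMr ?expR_gt0 //.
apply: (@le_trans _ _ (e * (eps / 2 * ln (ln n.-1%:R)))).
  apply: (@le_trans _ _ (e * (eps / 2 * (2 * C / (eps * e))))).
    rewrite le_eqVlt; apply/orP; left; apply/eqP; clear -e0 e_gt0; field.
    by rewrite !lt0r_neq0.
  by rewrite ler_pM2l // ler_pM2l // divr_gt0.
by rewrite ler_pM2l //; apply: le_trans h4; rewrite lerDr.
Qed.

Lemma Pr_ties_cvg : 0 < eps -> eps < 1 ->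
  (fun n : nat => Pr R (fun T : tournament n => (0 < num_ties (t_ eps n.-1) T)%N))
    @ \oo --> (0 : R).
Proof.
move=> e0 e1; apply: cvg_to0_ln => [n|e e_gt0]; first exact: Pr_ge0.
pose C : R := 16 * 216 * expR 1.
exists (Num.max (1000 * 864) (C / e)) => n.
rewrite ge_max => /andP[h1 h2]; apply: (le_trans (Pr_ties_le e0 e1 h1)); rewrite -/C.
have L0 : 0 < ln n.-1%:R :> R by clear -h1; lra.
by rewrite ler_pdivrMr // mulrC -ler_pdivrMr.
Qed.

End Asymptotics.

(** * From ties above the threshold to uniqueness *)

Lemma score_lt (n : nat) (T : tournament n) (i : 'I_n) : (score T i < n)%N.
Proof.
have n0 : (0 < n)%N by apply: leq_trans (ltn_ord i).
apply: (@leq_ltn_trans (\sum_(j < n | j != i) 1)).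
  by apply: leq_sum => j _; case: beats.
by rewrite sum1_card cardC1 card_ord prednK.
Qed.

(** The maximum is attained, so if not exactly once then by two players; [score_lt] makes their
    common score an element of ['I_n]. *)
Lemma ties_of_not_unique_max (n t : nat) (T : tournament n) :
  (t < max_score T)%N -> ~~ unique_max T -> (0 < num_ties t T)%N.
Proof.
move=> tM; rewrite /unique_max => nu.
(* Without players the maximum would be 0, which does not exceed [t]. *)
have n0 : (0 < #|'I_n|)%N.
  by rewrite card_ord; case: n T tM {nu} => // T; rewrite /max_score big_ord0.
have [i0 iM] := bigop.eq_bigmax (score T) n0.
have : (1 < #|[set i : 'I_n | score T i == max_score T]%SET|)%N.
  rewrite ltn_neqAle eq_sym nu; apply/card_gt0P; exists i0.
  by rewrite finset.in_set /max_score iM.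
move=> /card_gt1P[u [v [+ + uv]]]; rewrite !finset.in_set => /eqP hu /eqP hv.
apply/card_gt0P; exists (u, v); rewrite finset.in_set /= uv /=.
apply/existsP; exists (Ordinal (score_lt T u)) => /=.
by rewrite eqxx hu hv eqxx lez_nat ltnW.
Qed.

Theorem theorem1 (R : realType) :
  (fun n : nat => Pr R (fun T : tournament n => unique_max T)) @ \oo --> (1 : R)
  /\
  (forall eps : R, 0 < eps -> eps < 1 ->
     ((fun n : nat =>
         Pr R (fun T : tournament n => t_ eps n.-1 < (max_score T)%:Z))
        @ \oo --> (1 : R))
     /\
     ((fun n : nat =>
         Pr R (fun T : tournament n => (0 < num_ties (t_ eps n.-1) T)%N))
        @ \oo --> (0 : R))).
Proof.
have compl (E : forall n, pred (tournament n)) :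
    (fun n => Pr R (fun T => ~~ E n T)) @ \oo --> (0 : R) ->
    (fun n => Pr R (E n)) @ \oo --> (1 : R).
  move=> h; have -> : (fun n => Pr R (E n)) = (fun n => 1 - Pr R (fun T => ~~ E n T)).
    by apply/funext => n; rewrite PrC subKr.
  by rewrite -[X in _ --> X](subr0 1); apply: cvgB => //; exact: cvg_cst.
split; last first.
  by move=> eps e0 e1; split; [apply: compl; exact: Pr_max_cvg|exact: Pr_ties_cvg].
apply: compl; have h0 : 0 < 2^-1 :> R by [].
have h1 : 2^-1 < 1 :> R by rewrite invf_lt1 // ltr1n.
have lim := cvgD (Pr_max_cvg h0 h1) (Pr_ties_cvg h0 h1); rewrite addr0 in lim.
apply: (@squeeze_cvgr _ _ _ _ (cst 0) _ _ _ _ (cvg_cst 0) (lim _)).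
apply: nearW => n; rewrite Pr_ge0 /=.
(* The boolean index separates the two ways to fail: maximum not above the threshold, or a tie at or
   above it. *)
apply: (@le_trans _ _ (\sum_(b : bool) Pr R (fun T : tournament n =>
    if b then ~~ (t_ 2^-1 n.-1 < (max_score T)%:Z)
    else (0 < num_ties (t_ (2^-1 : R) n.-1) T)%N))); last by rewrite big_bool; exact: lexx.
apply: Pr_le_sum => T nu; have [t tE _] := t_bounds (2^-1 : R) n.-1.
case: (boolP (t_ (2^-1 : R) n.-1 < (max_score T)%:Z)) => [h|h]; last by exists true.
by exists false; move: h; rewrite tE ltz_nat => h; exact: ties_of_not_unique_max.
Qed.
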